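(* Let $K\subseteq\mathbb{R}^n$ be non-empty and closed and let $s=(s_\alpha)_{\alpha\in\mathbb{N}_0^n}$ be a real sequence. Then the following are equivalent: (i) $D(s)$ is a determinate $K$-positivity preserver; (ii) $s$ is a determinate $K^\sharp$-moment sequence.
   Context: $D(s):=\sum_{\alpha\in\mathbb{N}_0^n}\frac{s_\alpha}{\alpha!}\partial^\alpha$, acting on $\mathbb{R}[x_1,\dots,x_n]$. A linear map $T$ is a $K$-positivity preserver if $T\,\mathrm{Pos}(K)\subseteq\mathrm{Pos}(K)$, where $\mathrm{Pos}(K)$ is the set of polynomials non-negative on $K$. A $K$-positivity preserver $T=\sum_\alpha q_\alpha\partial^\alpha$ is called determinate if for every $y\in K$ the moment sequence $(\alpha!\,q_\alpha(y))_{\alpha}$ is determinate, i.e. has exactly one representing measure on $\mathbb{R}^n$. $K^\sharp:=\{x\in\mathbb{R}^n : x+K\subseteq K\}$. For closed $L\subseteq\mathbb{R}^n$, $s$ is an $L$-moment sequence if $s_\alpha=\int x^\alpha\,\mathrm{d}\mu$ for all $\alpha$ for some measure $\mu$ (a representing measure) with $\mathrm{supp}\,\mu\subseteq L$; it is determinate if it has only one representing measure on $\mathbb{R}^n$. *)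

(* Defs.v *)
From HB Require Import structures.
From mathcomp Require Import all_boot all_order all_algebra.
From mathcomp Require Import all_classical all_reals all_analysis.
From mathcomp Require mpoly.
Import (canonicals, coercions) mpoly.

Set Implicit Arguments.
Unset Strict Implicit.
Unset Printing Implicit Defensive.

Import Order.TTheory GRing.Theory Num.Theory.
Import numFieldNormedType.Exports.
Local Open Scope classical_set_scope.
Local Open Scope ring_scope.

Section Defs.
Context (R : realType) (n : nat).

Notation mind := (mpoly.multinom n).
Notation poly := (mpoly.mpoly n R).
Notation pt := ('rV[R]_n).

Definition mfact (a : mind) : nat := (\prod_(i < n) (tnth (mpoly.multinom_val a) i)`!)%N.

Definition peval (p : poly) (x : pt) : R := mpoly.meval (fun i => x ord0 i) p.

Definition mono (a : mind) (x : pt) : R := \prod_(i < n) x ord0 i ^+ tnth (mpoly.multinom_val a) i.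

Definition pderiv (a : mind) (p : poly) : poly := mpoly.mderivm a p.

(* T = sum_alpha q_alpha d^alpha acting on R[x]: on a given p only the
   finitely many alpha with |alpha| < msize p (= deg p + 1) contribute,
   all other terms d^alpha p vanish. *)
Definition msz (p : poly) : nat :=
  (\max_(m <- mpoly.msupp p) (mpoly.mdeg m).+1)%N.

Definition diffop (q : mind -> poly) (p : poly) : poly :=
  \sum_(a : mpoly.bmultinom n (msz p))
     q (mpoly.bmnm a) * pderiv (mpoly.bmnm a) p.

Definition Dcoef (s : mind -> R) (a : mind) : poly :=
  mpoly.mpolyC n (s a / (mfact a)%:R).

Definition Dop (s : mind -> R) : poly -> poly := diffop (Dcoef s).

Definition Pos (K : set pt) : set poly :=
  [set p | forall x, K x -> 0 <= peval p x].

Definition pos_preserver (K : set pt) (T : poly -> poly) : Prop :=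
  forall p, Pos K p -> Pos K (T p).

Definition Rn := g_sigma_algebraType (@open pt).

Definition representing (mu : {measure set Rn -> \bar R}) (s : mind -> R) :=
  forall a, mu.-integrable setT (fun x : Rn => (mono a x)%:E) /\
    (\int[mu]_(x in setT) (mono a x)%:E = (s a)%:E)%E.

Definition supp (mu : {measure set Rn -> \bar R}) : set pt :=
  [set x | forall U : set pt, open U -> U x -> (0 < mu U)%E].

Definition moment_seq (L : set pt) (s : mind -> R) : Prop :=
  exists mu : {measure set Rn -> \bar R}, representing mu s /\ supp mu `<=` L.

Definition determinate (s : mind -> R) : Prop :=
  (exists mu : {measure set Rn -> \bar R}, representing mu s) /\
  forall mu nu : {measure set Rn -> \bar R},
    representing mu s -> representing nu s ->
    forall A : set Rn, measurable A -> mu A = nu A.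

Definition determinate_coef (K : set pt) (q : mind -> poly) : Prop :=
  forall y, K y -> determinate (fun a => (mfact a)%:R * peval (q a) y).

Definition det_pos_preserver (K : set pt) (q : mind -> poly) : Prop :=
  pos_preserver K (diffop q) /\ determinate_coef K q.

Definition Ksharp (K : set pt) : set pt := [set x | forall k, K k -> K (x + k)].

End Defs.

(* Main.v *)
Require Import Defs.
From HB Require Import structures.
From mathcomp Require Import all_boot all_order all_algebra.
From mathcomp Require Import all_classical all_reals all_analysis.
From mathcomp Require Import measurable_realfun ring lra.
From mathcomp Require mpoly ssrcomplements.
Import -(notations) mpoly.

(** Write [L s] for the functional sending the monomial of exponent [a] to
    [s a]. By Taylor's formula, [D(s) p] at [y] is [L s] applied to the
    translate [p(y + X)]. Hence if [mu] represents [s] and is supported in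
    [Ksharp K], then [D(s) p (y)] is the integral of [x |-> p(y + x)], which is
    nonnegative on the support when [p] is nonnegative on [K] and [y] is in [K].
    Conversely, if [D(s)] preserves positivity on [K] then for each [y] in [K]
    the functional [L s] is nonnegative on the polynomials nonnegative on
    [K - y]; by Haviland's theorem [s] has a representing measure supported in
    [K - y], and by determinacy it is the same measure for all [y], so its
    support lies in the intersection of the sets [K - y], which is [Ksharp K].

    Haviland's theorem is obtained as follows. The functional is extended, by
    the M. Riesz extension theorem, to all functions dominated on [C] by a
    polynomial. On indicators the extension is a finitely additive measure
    defined on all subsets of [R^n]; it becomes countably additive on the space
    of ultrafilters of [R^n], because the latter is compact. Almost every
    ultrafilter converges, since the second moments are finite, and the image of
    the measure by the limit map is the representing measure. *)

Set Implicit Arguments.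
Unset Strict Implicit.
Unset Printing Implicit Defensive.

Import Order.TTheory GRing.Theory Num.Theory.
Import numFieldNormedType.Exports.
Local Open Scope classical_set_scope.
Local Open Scope ring_scope.

(** * Taylor expansion of polynomials *)

Section polynomials.
Context (R : realType) (n : nat).
Local Notation poly := (mpoly n R).
Implicit Types (p q : poly) (x y : 'rV[R]_n) (a : multinom n).

Local Notation "p @_ m" := (mcoeff m p) (at level 3, m at level 2).

Definition shift_poly y p : poly :=
  comp_mpoly [tuple mpolyX R (mnm1 i) + mpolyC n (y ord0 i) | i < n] p.

Lemma mnm_neq0_ex (m : multinom n) : m != mnm0 -> exists i, m i != 0%N.
Proof.
move=> m0; apply/existsP; apply: contraR m0 => /existsPn m0.
by apply/eqP/mnmP => i; rewrite mnm0E; apply/eqP; rewrite -[_ == _]negbK m0.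
Qed.

Lemma multinom_ind (Q : multinom n -> Prop) :
  Q mnm0 -> (forall m i, Q m -> Q (mnm_add m (mnm1 i))) -> forall m, Q m.
Proof.
move=> Q0 QS m; have [d] := ubnP (mdeg m); elim: d m => // d IH m md.
have [m0|m0] := eqVneq m mnm0; first by rewrite m0.
have [i mi] := mnm_neq0_ex m0.
rewrite -(@submK _ (mnm1 i) m) ?lep1mP//; apply: QS; apply: IH.
have : mdeg (mnm_add (mnm_sub m (mnm1 i)) (mnm1 i)) = mdeg m.
  by rewrite submK ?lep1mP.
by rewrite mdegD mdeg1 addn1 => mE; move: md; rewrite -mE.
Qed.

(** Both sides are linear in [p], so monomials suffice; these follow by induction on the exponent
    with the product rule, as [X_i + y_i] and [X_i] have the same derivatives. *)
Lemma mderiv_shift_poly i y p :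
  mderiv i (shift_poly y p) = shift_poly y (mderiv i p).
Proof.
have monoE m : mderiv i (shift_poly y (mpolyX R m)) =
    shift_poly y (mderiv i (mpolyX R m)).
  elim/multinom_ind : m => [|m j IH].
    by rewrite mpolyX0 {1}/shift_poly comp_mpoly1 -mpolyC1 !mderivC
      /shift_poly comp_mpoly0.
  have shM q q' : shift_poly y (q * q') = shift_poly y q * shift_poly y q'.
    by rewrite /shift_poly rmorphM.
  have shD q q' : shift_poly y (q + q') = shift_poly y q + shift_poly y q'.
    by rewrite /shift_poly comp_mpolyD.
  rewrite mpolyXD shM !mderivM IH shD !shM; congr (_ + _ * _).
  rewrite {1}/shift_poly comp_mpolyXU -tnth_nth tnth_mktuple mderivD mderivC
    addr0.
  rewrite mderivX mnm1E; case: eqP => [->|_]; last first.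
    by rewrite !scale0r /shift_poly comp_mpoly0.
  by rewrite -[X in mnm_sub X]add0m addmK mpolyX0 !scale1r /shift_poly
    comp_mpoly1.
elim/mpolyind : p => [|c m p _ _ IH].
  by rewrite /shift_poly comp_mpoly0 !mderiv0 comp_mpoly0.
rewrite /shift_poly !(comp_mpolyD, comp_mpolyZ, mderivD, mderivZ).
by rewrite -!/(shift_poly _ _) IH monoE.
Qed.

Lemma mderivm_shift_poly a y p :
  mderivm a (shift_poly y p) = shift_poly y (mderivm a p).
Proof.
rewrite /mderivm; elim: (enum _) => //= i r ->.
by elim: (a i) => //= k ->; rewrite mderiv_shift_poly.
Qed.

Lemma peval_shift_poly y p x : peval (shift_poly y p) x = peval p (x + y).
Proof.
rewrite /peval /shift_poly comp_mpoly_meval.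
apply: eq_bigr => a _; congr (_ * _); apply: eq_bigr => i _; congr (_ ^+ _).
by rewrite tnth_map tnth_ord_tuple mevalD mevalXU mevalC mxE.
Qed.

Lemma shift_polyK y : cancel (shift_poly (- y)) (shift_poly y).
Proof.
move=> p; rewrite -[RHS]comp_mpoly_id.
elim/mpolyind : p => [|c m p _ _ IH].
  by rewrite /shift_poly !comp_mpoly0.
rewrite /shift_poly !(comp_mpolyD, comp_mpolyZ) -!/(shift_poly _ _) IH.
congr (_ *: _ + _).
rewrite /shift_poly !comp_mpolyX rmorph_prod /=; apply: eq_bigr => i _.
rewrite rmorphXn/= !tnth_map tnth_ord_tuple comp_mpolyD comp_mpolyC.
by rewrite comp_mpolyXU -tnth_nth tnth_mktuple mxE mpolyCN addrK.
Qed.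

Lemma mcoeff0_peval p : p @_ mnm0 = peval p 0.
Proof.
elim/mpolyind : p => [|c m p _ _ IH]; first by rewrite mcoeff0 /peval meval0.
rewrite /peval mevalD mevalZ mevalX mcoeffD mcoeffZ -/(peval _ _) -IH.
congr (_ * _ + _); rewrite mcoeffX; case: eqP => [->|/eqP m0].
  by rewrite big1// => i _; rewrite mnm0E expr0.
have [i mi] := mnm_neq0_ex m0.
by rewrite (bigD1 i)//= mxE expr0n (negbTE mi) mul0r.
Qed.

(** Taylor's formula: the coefficients of [p(X + y)] are derivatives at [0] of
    [p(X + y)], and differentiation commutes with translation. *)
Lemma mcoeff_shift_poly a y p :
  (mfact a)%:R * (shift_poly y p) @_ a = peval (pderiv a p) y.
Proof.
rewrite /pderiv -[in RHS](add0r y) -peval_shift_poly -mderivm_shift_poly.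
rewrite -mcoeff0_peval mcoeff_mderivm addm0 mulr_natl; congr (_ *+ _).
by apply: eq_bigr => i _; rewrite ffactnn.
Qed.

Definition moment_functional (s : multinom n -> R) p : R :=
  \sum_(a <- msupp p) p @_ a * s a.

(** Polynomials with different supports can thus be summed over one common range of exponents, from
    which linearity is read off. *)
Lemma moment_functionalwE s p k : (msize p <= k)%N ->
  moment_functional s p = \sum_(a : bmultinom n k) p @_ a * s a.
Proof.
move=> pk; rewrite /moment_functional
  (ssrcomplements.big_mksub (bmultinom n k))//=; last first.
- by move=> x /msize_mdeg_lt /leq_trans; apply.
- exact: msupp_uniq.
by rewrite big_rmcond //= => i /memN_msupp_eq0 ->; rewrite mul0r.
Qed.

Lemma moment_functionalX s a : moment_functional s (mpolyX R a) = s a.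
Proof. by rewrite /moment_functional msuppX big_seq1 mcoeffX eqxx mul1r. Qed.

Lemma moment_functional_is_linear s : linear_for *%R (moment_functional s).
Proof.
move=> c p q; pose k := maxn (msize (c *: p + q)) (maxn (msize p) (msize q)).
rewrite !(@moment_functionalwE s _ k) ?leq_max ?leqnn ?orbT//.
rewrite mulr_sumr -big_split; apply: eq_bigr => a _ /=.
by rewrite mcoeffD mcoeffZ mulrDl mulrA.
Qed.

Lemma mfact_gt0 (a : multinom n) : (0 < mfact a)%N.
Proof. by apply: prodn_gt0 => i; rewrite fact_gt0. Qed.

(** The denominator [a!] in [Dcoef] cancels the factorial in Taylor's formula. *)
Lemma peval_Dop s p y :
  peval (Dop s p) y = moment_functional s (shift_poly y p).
Proof.
rewrite /Dop /diffop /peval rmorph_sum/=.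
transitivity (\sum_(a : bmultinom n (msz p)) (shift_poly y p) @_ a * s a).
  apply: eq_bigr => a _; rewrite mevalM mevalC -/(peval _ _).
  rewrite -mcoeff_shift_poly mulrA divfK 1?mulrC//.
  by rewrite pnatr_eq0 -lt0n mfact_gt0.
(* The size of the translate remains to be bounded: if [|a|] is at least [msz p], then [pderiv a p]
   vanishes, and with it the coefficient of the translate at [a]. *)
rewrite -moment_functionalwE//; apply/bigmax_leqP_seq => a ap _.
rewrite ltnNge; apply: contraL ap => pa.
have := mcoeff_shift_poly a y p; suff -> : pderiv a p = 0.
  rewrite /peval meval0 => /eqP; rewrite mulf_eq0 pnatr_eq0 gtn_eqF
    ?mfact_gt0//=.
  by rewrite mcoeff_eq0.
apply/mpolyP => b; rewrite mcoeff_mderivm mcoeff0 memN_msupp_eq0 ?mul0rn//.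
by apply: msize_mdeg_ge; rewrite mdegD (leq_trans pa)// leq_addr.
Qed.

End polynomials.

(** * The M. Riesz extension theorem *)

Section riesz_extension.
Context (R : realType) (V : lmodType R).
Implicit Types (P : set V) (G : set (V * R)) (v w : V).

(** [G] is the graph of a linear functional on a subspace, nonnegative on [P];
    being a function is implied: if [(0, r)] is in [G] then so is [(0, - r)],
    and [0] is in [P]. *)
Definition positive_graph P G := [/\ G (0, 0),
  forall a v w r t, G (v, r) -> G (w, t) -> G (a *: v + w, a * r + t) &
  forall v r, P v -> G (v, r) -> 0 <= r].

Definition extend_graph G v c : set (V * R) :=
  [set z | exists w r a, [/\ G (w, r), z.1 = w + a *: v & z.2 = r + a * c]].

(** For [w + a *: v] in the cone with [a] nonzero, dividing by [|a|] turns the claim into one of the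
    two comparisons of [c] with a value of [G]. *)
Lemma positive_graph_extend P G v c :
  (forall a w, 0 <= a -> P w -> P (a *: w)) ->
  positive_graph P G ->
  (forall w r, P (v - w) -> G (w, r) -> r <= c) ->
  (forall w r, P (w - v) -> G (w, r) -> c <= r) ->
  positive_graph P (extend_graph G v c).
Proof.
move=> PZ [G0 GL Gpos] lec gec; have GZ a w r : G (w, r) -> G (a *: w, a * r).
  by move=> Gw; have := GL a _ _ _ _ Gw G0; rewrite !addr0.
split.
- by exists 0, 0, 0; rewrite scale0r mul0r !addr0.
- move=> b _ _ _ _ [w [r [a [Gw /= -> ->]]]] [w' [r' [a' [Gw' /= -> ->]]]].
  exists (b *: w + w'), (b * r + r'), (b * a + a'); split; first exact: GL.
    by rewrite /= scalerDr scalerDl addrACA scalerA.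
  by rewrite /= mulrDr mulrDl addrACA mulrA.
- move=> u _ Pz [w [r [a [Gw /= zE ->]]]]; rewrite {}zE in Pz *.
  have [a0|a0|a0] := ltgtP a 0; last first.
  + by move: Pz; rewrite a0 scale0r mul0r !addr0 => /Gpos; apply.
  + have : - (a^-1 * r) <= c.
      apply: (lec (- a^-1 *: w)); last by rewrite -mulNr; exact: GZ.
      have := PZ a^-1 _ _ Pz; rewrite scalerDr scalerA mulVf ?gt_eqF// scale1r.
      by rewrite scaleNr opprK addrC; apply; rewrite invr_ge0 ltW.
    rewrite -(ler_pM2l a0) mulrN mulVKf ?gt_eqF// => ?.
    by rewrite addrC -lerBlDr sub0r.
  + have : c <= - (a^-1 * r).
      apply: (gec (- a^-1 *: w)); last by rewrite -mulNr; exact: GZ.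
      have := PZ (- a^-1) _ _ Pz; rewrite scalerDr scalerA mulNr mulVf
        ?lt_eqF//.
      by rewrite scaleN1r; apply; rewrite oppr_ge0 invr_le0 ltW.
    rewrite -(ler_nM2l a0) mulrN mulVKf ?lt_eqF// => ?.
    by rewrite addrC -lerBlDr sub0r.
Qed.

(** Zorn's lemma gives a maximal positive extension. A vector between two elements of its domain, in
    the order of the cone [P], can always be adjoined, hence already has a value. *)
Lemma riesz_extension P G : P 0 ->
  (forall a v, 0 <= a -> P v -> P (a *: v)) ->
  (forall v w, P v -> P w -> P (v + w)) ->
  positive_graph P G ->
  exists F, [/\ positive_graph P F, G `<=` F &
    forall v, (exists z, F z /\ P (v - z.1)) ->
      (exists z, F z /\ P (z.1 - v)) ->
      exists r, F (v, r)].
Proof.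
move=> P0 PZ PD PG.
pose A := [set F | positive_graph P F /\ G `<=` F].
have [F [[PF GF] Fmax]] : exists F, A F /\ forall F', F `<` F' -> ~ A F'.
  have [|F [AF Fmax]] := @Zorn_bigcup _ [set F | F = set0 \/ A F].
    move=> C CA Ctot; have [[F [CF F0]]|C0] :=
      pselect (exists F, C F /\ F !=set0); last first.
      left; apply/seteqP; split => // z [F CF Fz]; apply: C0.
      by exists F; split => //; exists z.
    have AF : A F by have [F0'|//] := CA _ CF; move: F0; rewrite F0' => -[].
    have inA F' z : C F' -> F' z -> A F'.
      by move=> CF' F'z; have [F'0|//] := CA _ CF'; move: F'z; rewrite F'0.
    right; split; last by move=> z Gz; exists F => //; exact: AF.2.
    split.
    + by exists F => //; case: AF.1.
    + move=> a v w r t [F1 CF1 F1v] [F2 CF2 F2w].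
      have [F12|F21] := Ctot _ _ CF1 CF2.
        exists F2 => //; have [[_ FL _] _] := inA _ _ CF2 F2w.
        by apply: FL => //; exact: F12.
      exists F1 => //; have [[_ FL _] _] := inA _ _ CF1 F1v.
      by apply: FL => //; exact: F21.
    + move=> v r Pv [F1 CF1 F1v]; have [[_ _ Fp] _] := inA _ _ CF1 F1v.
      exact: Fp F1v.
  (* The maximal element is not empty, since [G] contains [(0, 0)]. *)
  have AF' : A F.
    case: AF => // F0; exfalso; apply: (Fmax G) => //; last by right; split.
    by rewrite F0; split => // G0; case: PG => /G0.
  by exists F; split => // F' FF' AF1; apply: (Fmax F') => //; right.
exists F; split => // v [[w r]/= [Fw Pw]] [[w' r']/= [Fw' Pw']].
have [F0 FL Fpos] := PF.
have FB u u' t t' : F (u, t) -> F (u', t') -> F (u - u', t - t').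
  move=> Fu Fu'; have := FL (-1) _ _ _ _ Fu' Fu.
  by rewrite scaleN1r mulN1r !(addrC (- _)).
(* The values at vectors below [v]. The two squeezing elements make this set nonempty and bounded,
   and its supremum is an admissible value at [v]. *)
pose S := [set t | exists u, F (u, t) /\ P (v - u)].
pose c := sup S.
have ubS u t : F (u, t) -> P (u - v) -> ubound S t.
  move=> Fu Pu t' [u' [Fu' Pu']].
  rewrite -subr_ge0; apply: (Fpos (u - u')); last exact: FB.
  by have := PD _ _ Pu Pu'; rewrite addrA subrK.
have FE : F `<=` extend_graph F v c.
  by move=> [u t] Fu; exists u, t, 0; rewrite /= scale0r mul0r !addr0.
exists c; apply: contrapT => Fvc; apply: (Fmax (extend_graph F v c)).
  split => // EF; apply/Fvc/EF.
  by exists 0, 0, 1; rewrite /= !add0r scale1r mul1r.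
split.
  apply: positive_graph_extend => //.
    move=> u t Pu Fu; apply: ub_le_sup; last by exists u.
    by exists r'; exact: ubS Pw'.
  move=> u t Pu Fu; apply: ge_sup; first by exists r, w.
  exact: ubS Pu.
exact: subset_trans FE.
Qed.

End riesz_extension.

(** * Finitely additive measures on the space of ultrafilters *)

Definition ultrafilters (X : Type) := {U : set_system X | UltraFilter U}.

Definition principal_ultrafilter X (x : X) : ultrafilters X :=
  exist _ (principal_filter x) (principal_filter_ultra x).

(** Basic clopen sets of the Stone-Cech compactification of discrete [X]. *)
Definition ultra_clopen X (A : set X) : set (ultrafilters X) :=
  [set U | projT1 U A].

Fact ultra_display : measure_display.
Proof. exact: default_measure_display. Qed.

Section ultrafilters_algebra.
Context (X : pointedType).
Implicit Types (A B : set X) (U : ultrafilters X).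

HB.instance Definition _ := gen_eqMixin (ultrafilters X).
HB.instance Definition _ := gen_choiceMixin (ultrafilters X).
HB.instance Definition _ :=
  isPointed.Build (ultrafilters X) (principal_ultrafilter point).

Lemma ultraP U : UltraFilter (projT1 U). Proof. exact: projT2. Qed.

Lemma ultra_clopen0 : ultra_clopen (@set0 X) = set0.
Proof.
apply/seteqP; split => // U U0; have UF := ultraP U.
by have [] := filter_ex U0.
Qed.

Lemma ultra_clopenC A : ultra_clopen (~` A) = ~` ultra_clopen A.
Proof.
apply/seteqP; split => U /= UA; have UF := ultraP U.
  by move=> UA'; have [x []] := filter_ex (filterI UA UA').
by have [] := in_ultra_setVsetC A UF.
Qed.

Lemma ultra_clopenI A B :
  ultra_clopen (A `&` B) = ultra_clopen A `&` ultra_clopen B.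
Proof.
apply/seteqP; split => U /=; have UF := ultraP U.
  by move=> UAB; split; apply: filterS UAB => x [].
by move=> [? ?]; exact: filterI.
Qed.

Lemma ultra_clopenU A B :
  ultra_clopen (A `|` B) = ultra_clopen A `|` ultra_clopen B.
Proof.
rewrite -[LHS]setCK -ultra_clopenC setCU ultra_clopenI !ultra_clopenC.
by rewrite setCI !setCK.
Qed.

(** A set is recovered from its clopen, so a set function on [X] transfers to clopens without
    choosing representatives. *)
Lemma preimage_ultra_clopen A :
  @principal_ultrafilter X @^-1` (ultra_clopen A) = A.
Proof.
by apply/seteqP; split => x /principal_filterP.
Qed.

Let clopens : set (set (ultrafilters X)) := range (@ultra_clopen X).

Let clopens0 : clopens set0.
Proof. by exists set0 => //; rewrite ultra_clopen0. Qed.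

Let clopensU : setU_closed clopens.
Proof.
by move=> _ _ [A _ <-] [B _ <-]; exists (A `|` B); rewrite ?ultra_clopenU.
Qed.

Let clopensC : setC_closed clopens.
Proof. by move=> _ [A _ <-]; exists (~` A) => //; rewrite ultra_clopenC. Qed.

HB.instance Definition _ := isAlgebraOfSets.Build ultra_display
  (ultrafilters X) clopens0 clopensU clopensC.

(** Without a finite subcover the sets [D N] generate a proper filter; an ultrafilter finer than it
    contains [A] but none of the [B i]. *)
Lemma ultra_clopen_compact A (B : (set X)^nat) :
  ultra_clopen A `<=` \bigcup_i ultra_clopen (B i) ->
  exists N, A `<=` \bigcup_(i < N) B i.
Proof.
move=> AB; apply: contrapT => /forallNP ABN.
pose D N := A `\` \bigcup_(i < N) B i.
have DF : ProperFilter (filter_from setT D).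
  apply: filter_from_proper.
    apply: filter_from_filter; first by exists 0%N.
    move=> i j _ _; exists (maxn i j) => // x [Ax nBx]; split; split => //;
      by move=> [k /= ki Bkx]; apply: nBx; exists k => //=;
        rewrite leq_max ki ?orbT.
  move=> N _; apply: contrapT => D0; apply: (ABN N) => x Ax.
  by apply: contrapT => nBx; apply: D0; exists x.
have [W [WU DW]] := ultraFilterLemma DF.
have [|i _] := AB (exist _ W WU).
  by apply: DW; exists 0%N => // x [].
rewrite /ultra_clopen/= => WB.
have WD : W (D i.+1) by apply: DW; exists i.+1.
by have [x [Bx [_]]] := filter_ex (filterI WB WD); apply; exists i => //=.
Qed.

End ultrafilters_algebra.

Section stone_measure.
Context (X : pointedType) (R : realType) (m : set X -> R).
Hypothesis m_ge0 : forall A, 0 <= m A.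
Hypothesis m_additive : forall A B, A `&` B = set0 -> m (A `|` B) = m A + m B.
Local Open Scope ereal_scope.

Let m0 : m set0 = 0%R.
Proof.
by apply: (addrI (m set0)); rewrite -m_additive ?setI0// setU0 addr0.
Qed.

Definition stone_content (S : set (ultrafilters X)) : \bar R :=
  (m (@principal_ultrafilter X @^-1` S))%:E.

Let stone_content0 : stone_content set0 = 0.
Proof. by rewrite /stone_content preimage_set0 m0. Qed.

Let stone_content_ge0 S : 0 <= stone_content S.
Proof. by rewrite lee_fin. Qed.

Let stone_content_sum (F : (set (ultrafilters X))^nat) N : trivIset setT F ->
  stone_content (\big[setU/set0]_(i < N) F i) =
  \sum_(i < N) stone_content (F i).
Proof.
move=> tF; elim: N => [|N IH]; first by rewrite !big_ord0.
rewrite !big_ord_recr/= -IH /stone_content preimage_setU m_additive//.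
rewrite -preimage_setI -bigcup_mkord; apply/seteqP;
  split => // x [[i /= iN Fi] FN].
by have := tF i N I I (ex_intro _ _ (conj Fi FN)); move: iN => /[swap] ->;
  rewrite ltnn.
Qed.

(* A clopen disjoint union of clopen sets has, by compactness, only finitely
   many nonempty members. *)
Let stone_content_sigma_additive : semi_sigma_additive stone_content.
Proof.
move=> F mF tF mUF.
pose B i := @principal_ultrafilter X @^-1` F i.
have FB i : F i = ultra_clopen (B i).
  by have [A _ FA] := mF i; rewrite /B -FA preimage_ultra_clopen.
have [N BN] : exists N, \bigcup_i B i `<=` \bigcup_(i < N) B i.
  apply: ultra_clopen_compact; rewrite -[X in _ `<=` X](_ : \bigcup_n F n = _).
    have [A _ FA] := mUF; rewrite /B -preimage_bigcup -FA.
    by rewrite preimage_ultra_clopen.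
  by apply: eq_bigcupr => i _; exact: FB.
apply: cvg_near_cst; exists N => // n /= Nn.
rewrite big_mkord -stone_content_sum// /stone_content -bigcup_mkord.
congr (m _)%:E; rewrite !preimage_bigcup; apply/seteqP; split.
  by move=> x [i _ Bx]; exists i.
by move=> x /BN[i /= iN Bx]; exists i => //=; exact: leq_trans Nn.
Qed.

HB.instance Definition _ := measure_function.isMeasure.Build _ _ _ stone_content
  stone_content0 stone_content_ge0 stone_content_sigma_additive.

(** This is the Caratheodory extension of [stone_content], which is already countably additive on
    the clopens. *)
Lemma stone_measure : exists mu : {measure set
    (g_sigma_algebraType (@measurable _ (ultrafilters X))) -> \bar R},
  forall A, mu (ultra_clopen A) = (m A)%:E.
Proof.
exists (measure_extension stone_content) => A.
have mA : measurable (ultra_clopen A) by exists A.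
transitivity (stone_content (ultra_clopen A)); first exact: measurable_mu_extE.
by rewrite /stone_content preimage_ultra_clopen.
Qed.

End stone_measure.

(** * Functionals on polynomially dominated functions *)

Section positive_extension.
Context (R : realType) (n : nat) (C : set 'rV[R]_n) (L : mpoly n R -> R).
Local Notation pt := 'rV[R]_n.
Hypothesis L_linear : linear_for *%R L.
Hypothesis L_pos : forall p, Pos C p -> 0 <= L p.

Definition poly_dominated (f : pt -> R) :=
  exists p : mpoly n R, forall x, C x -> `|f x| <= peval p x.

(** Riesz extension from the polynomial functions, for the cone of functions nonnegative on [C]. A
    function dominated by [p] lies between [- p] and [p] on [C], so the extension is defined
    there. *)
Lemma positive_extension : exists F : (pt -> R) -> R, [/\
  forall p, F (peval p) = L p,
  forall a f g, poly_dominated f -> poly_dominated g ->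
    F (fun x => a * f x + g x) = a * F f + F g &
  forall f, poly_dominated f -> (forall x, C x -> 0 <= f x) -> 0 <= F f].
Proof.
pose P : set (pt -> R^o) := [set f | forall x, C x -> 0 <= f x].
pose G : set ((pt -> R^o) * R) := [set z | exists p, z = (peval p, L p)].
have PG : positive_graph P G.
  split.
  - exists 0; have := L_linear (-1) 0 0; rewrite scaler0 addr0 mulN1r addNr =>
    ->.
    by congr pair; apply/funext => x; rewrite /peval meval0.
  - move=> a _ _ _ _ [p [-> ->]] [q [-> ->]]; exists (a *: p + q).
    rewrite L_linear; congr pair; apply/funext => x.
    by rewrite /peval mevalD mevalZ.
  - by move=> v r Pv [p [vE ->]]; apply: L_pos => x Cx; rewrite -vE; exact: Pv.
have [|a f a0 fP x Cx|f g fP gP x Cx|H [[H0 HL Hpos] GH Htot]] :=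
  riesz_extension _ _ _ PG.
- by move=> x _.
- by rewrite mulr_ge0// fP.
- by rewrite addr_ge0// ?fP ?gP.
(* Two values at [f] differ by a value at [0], which is nonnegative because [0] is in the cone; by
   symmetry they agree. *)
have Hfun f r t : H (f, r) -> H (f, t) -> r = t.
  move=> Hr Ht; have nneg u v : H (f, u) -> H (f, v) -> v <= u.
    move=> Hu Hv; rewrite -subr_ge0; apply: (Hpos 0); first by move=> x.
    have := HL (-1) _ _ _ _ Hv Hu.
    by rewrite scaleN1r addNr mulN1r addrC.
  by apply/eqP; rewrite eq_le !nneg.
have Htotal f : poly_dominated f -> exists r, H (f, r).
  move=> [p fp]; apply: Htot.
    exists (peval (- p), L (- p)); split; first by apply: GH; exists (- p).
    move=> x Cx; have -> : (f - peval (- p)) x = f x - - peval p x.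
      by rewrite /peval -mevalN.
    by have := fp x Cx; rewrite ler_norml subr_ge0 => /andP[].
  exists (peval p, L p); split; first by apply: GH; exists p.
  move=> x Cx; have := fp x Cx; rewrite ler_norml => /andP[_].
  by rewrite -subr_ge0.
(* The default [0] is taken only outside the domain of [H], hence never at a dominated function. *)
exists (fun f => xget 0 [set r | H (f, r)]).
have HF f : poly_dominated f -> H (f, xget 0 [set r | H (f, r)]).
  by move=> /Htotal[r Hr]; apply: (@xgetPex _ 0 [set r | H (f, r)]); exists r.
split.
- move=> p; apply: (Hfun (peval p)); last by apply: GH; exists p.
  by apply: (@xgetPex _ 0 [set r | H (peval p, r)]); exists (L p); apply: GH;
    exists p.
- move=> a f g fd gd; apply: (Hfun (fun x => a * f x + g x)).
    apply: (@xgetPex _ 0 [set r | H (fun x => a * f x + g x, r)]).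
    by exists (a * xget 0 [set r | H (f, r)] + xget 0 [set r | H (g, r)]);
      apply: HL; exact: HF.
  by apply: HL; exact: HF.
- by move=> f fd f0; apply: (Hpos f) => //; exact: HF.
Qed.

End positive_extension.

(** * Continuity of polynomial functions *)

Section topology.
Context (R : realType) (n : nat).
Local Notation pt := 'rV[R]_n.

Lemma continuous_peval (p : mpoly n R) : continuous (peval p : pt -> R).
Proof.
have monoc m : continuous (peval (mpolyX R m) : pt -> R).
  elim/multinom_ind : m => [|m i IH] x.
    have -> : peval (mpolyX R mnm0) = cst 1 :> (pt -> R).
      by apply/funext => y; rewrite /peval mpolyX0 meval1.
    exact: cst_continuous.
  have -> : peval (mpolyX R (mnm_add m (mnm1 i))) =
      peval (mpolyX R m) \* (fun y : pt => y ord0 i).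
    by apply/funext => y; rewrite /peval mpolyXD mevalM mevalXU.
  apply: continuousM; first exact: IH.
  exact: coord_continuous.
elim/mpolyind : p => [|c m p _ _ IH] x.
  have -> : peval (0 : mpoly n R) = cst 0 :> (pt -> R).
    by apply/funext => y; rewrite /peval meval0.
  exact: cst_continuous.
have -> : peval (c *: mpolyX R m + p) =
    (cst c \* peval (mpolyX R m)) + peval p :> (pt -> R).
  by apply/funext => y; rewrite /peval mevalD mevalZ.
exact: (continuousD (continuousM (@cst_continuous _ _ c x) (monoc m x)) (IH x)).
Qed.
End topology.

(** * Limits of ultrafilters *)

Section standard_part.
Context (R : realType) (n : nat).
Local Notation pt := 'rV[R]_n.
Local Notation ultra := (g_sigma_algebraType (@measurable _ (ultrafilters pt))).
Implicit Types (U : ultrafilters pt) (A V : set pt).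

Definition ultra_cvg : set (ultrafilters pt) :=
  [set U | exists x : pt, nbhs x `<=` projT1 U].

(** [0] when [U] does not converge. *)
Definition standard_part U : pt := xget 0 [set x : pt | nbhs x `<=` projT1 U].

Lemma standard_partP U : ultra_cvg U -> nbhs (standard_part U) `<=` projT1 U.
Proof.
move=> [x xU]; apply: (@xgetPex _ 0 [set x : pt | nbhs x `<=` projT1 U]).
by exists x.
Qed.

Lemma open_standard_part U V :
  ultra_cvg U -> open V -> V (standard_part U) -> ultra_clopen V U.
Proof.
by move=> /standard_partP cU oV VU; apply: cU; exact: open_nbhs_nbhs.
Qed.

Lemma closed_standard_part U A :
  ultra_cvg U -> closed A -> ultra_clopen A U -> A (standard_part U).
Proof.
move=> cU cA AU; apply: contrapT => nA.
have : ultra_clopen (~` A) U by apply: open_standard_part => //;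
  exact: closed_openC.
by rewrite ultra_clopenC.
Qed.

(** Being polynomial, it has a finite value under the functional, which bounds the mass at infinity;
    its sublevel sets are compact. *)
Definition sqnorm_poly : mpoly n R := \sum_(i < n) mpolyX R (mnm1 i) ^+ 2.

Lemma peval_sqnorm_poly (x : pt) :
  peval sqnorm_poly x = \sum_(i < n) x ord0 i ^+ 2.
Proof.
rewrite /peval rmorph_sum/=; apply: eq_bigr => i _.
by rewrite rmorphXn/= mevalXU.
Qed.

Definition sqball (r : R) : set pt := [set x | peval sqnorm_poly x <= r].

Lemma closed_sqball r : closed (sqball r).
Proof.
apply: (@closed_comp _ _ (peval sqnorm_poly : pt -> R) [set t | t <= r]).
  by move=> x _; exact: continuous_peval.
exact: closed_le.
Qed.

Lemma compact_sqball r : compact (sqball r).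
Proof.
apply: bounded_closed_compact; last exact: closed_sqball.
(* The bound comes from [|t| <= 1 + t ^ 2] applied to each coordinate. *)
exists (1 + r); split; first exact: num_real.
move=> M rM x; rewrite /sqball/= peval_sqnorm_poly => xr.
rewrite [leLHS]/Num.Def.normr/= mx_normrE; apply/bigmax_leP; split.
  apply: le_trans (ltW rM); rewrite addr_ge0//; apply: le_trans xr.
  by apply: sumr_ge0 => i _; rewrite sqr_ge0.
move=> [i j] _ /=; rewrite (ord1 i); apply: le_trans (ltW rM).
apply: (@le_trans _ _ (1 + x ord0 j ^+ 2)).
  by have := sqr_ge0 (`|x ord0 j| - 1); rewrite -[x ord0 j ^+ 2]real_normK
    ?num_real//; nra.
rewrite lerD2l; apply: le_trans xr; rewrite (bigD1 j)//= lerDl.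
by apply: sumr_ge0 => k _; rewrite sqr_ge0.
Qed.

(** An ultrafilter containing a compact ball converges, and a convergent one contains a ball around
    its limit. Convergence is thus a countable union of clopen conditions. *)
Lemma ultra_cvgE : ultra_cvg = \bigcup_N ultra_clopen (sqball N%:R).
Proof.
apply/seteqP; split => [U cU|U [N _ UN]]; last first.
  have := @compact_sqball N%:R; rewrite compact_ultra => /(_ _ (ultraP U) UN).
  by move=> [x [_ xU]]; exists x.
have [N xN] : exists N : nat, peval sqnorm_poly (standard_part U) < N%:R.
  exists (Num.truncn (peval sqnorm_poly (standard_part U))).+1.
  exact: truncnS_gt.
exists N => //; have UF := ultraP U.
have : ultra_clopen [set x : pt | peval sqnorm_poly x < N%:R] U.
  apply: open_standard_part => //.
  apply: (@open_comp _ _ (peval sqnorm_poly : pt -> R) [set t | t < N%:R]).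
    by move=> x _; exact: continuous_peval.
  exact: open_lt.
by apply: filterS => x /ltW.
Qed.

Lemma measurable_ultra_clopen A : measurable (ultra_clopen A : set ultra).
Proof. by apply: sub_sigma_algebra; exists A. Qed.

Lemma measurable_ultra_cvg : measurable (ultra_cvg : set ultra).
Proof.
rewrite ultra_cvgE; apply: bigcupT_measurable => N.
exact: measurable_ultra_clopen.
Qed.

Definition inner_nbhd V (k : nat) : set pt :=
  [set x | ball x k.+1%:R^-1 `<=` V].

(** An ultrafilter containing [V] may converge to a boundary point of [V]; a uniform margin
    [1 / (k + 1)] excludes this and expresses the position of the limit by countably many
    clopens. *)
Lemma standard_part_inner_nbhd U V : ultra_cvg U -> open V ->
  V (standard_part U) <-> exists k, ultra_clopen (inner_nbhd V k) U.
Proof.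
move=> cU oV; have UF := ultraP U; split => [VU|[k Uk]].
  have /nbhs_ballP[e /= e0 eV] := open_nbhs_nbhs (conj oV VU).
  have [k ke] : exists k, k.+1%:R^-1 < e / 2 :> R.
    exists (Num.truncn ((e / 2)^-1)).
    by rewrite invf_plt ?posrE ?divr_gt0// truncnS_gt.
  exists k; have := standard_partP cU (nbhsx_ballx (standard_part U) _
    (divr_gt0 e0 (ltr0Sn _ 1))).
  apply: filterS => x xU y xy; apply: eV.
  rewrite (splitr e); apply: ball_triangle xU _.
  by apply: le_ball xy; exact: ltW.
have k0 : 0 < k.+1%:R^-1 :> R by rewrite invr_gt0.
have Ub := standard_partP cU (nbhsx_ballx (standard_part U) _ k0).
by have [x [xU +]] := filter_ex (filterI Ub Uk); apply; exact: ball_sym.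
Qed.

Lemma measurable_standard_part :
  measurable_fun [set: ultra] (standard_part : ultra -> Rn R n).
Proof.
apply: (@measurability _ _ ultra (Rn R n) _ _ (@open pt)) => //.
move=> _ [V oV <-]; rewrite setTI.
(* On non-convergent ultrafilters the limit map is constantly [0], so that part of the preimage is
   everything or nothing, according to whether [V] contains [0]. *)
rewrite (_ : _ @^-1` _ =
    (ultra_cvg `&` \bigcup_k ultra_clopen (inner_nbhd V k)) `|`
    (~` ultra_cvg `&` [set U | V (standard_part U)])).
  apply: measurableU.
    apply: measurableI; first exact: measurable_ultra_cvg.
    by apply: bigcupT_measurable => k; exact: measurable_ultra_clopen.
  have [V0|V0] := pselect (V 0).
    rewrite setIidl; first by apply: measurableC; exact: measurable_ultra_cvg.
    move=> U nU /=; rewrite /standard_part; case: xgetP => // x _ xU.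
    by exfalso; apply: nU; exists x.
  rewrite (_ : _ `&` _ = set0); first exact: measurable0.
  apply/seteqP; split => // U [nU] /=; rewrite /standard_part;
    case: xgetP => // x _ xU.
  by exfalso; apply: nU; exists x.
apply/seteqP; split => U /=.
  move=> VU; have [cU|nU] := pselect (ultra_cvg U); last by right.
  by left; split => //; have [k Uk] := (standard_part_inner_nbhd cU oV).1 VU;
    exists k.
move=> [[cU [k _ Uk]]|[]//].
by apply/(standard_part_inner_nbhd cU oV); exists k.
Qed.

End standard_part.

(** * From a positive functional to a measure *)

(** The sum is [y] rounded down to a multiple of [d] and capped at [N * d]. *)
Lemma layer_cake_bounds (R : realFieldType) (d y : R) (N : nat) :
  0 < d -> 0 <= y ->
  Num.min (y - d) (N%:R * d) <= \sum_(j < N) d * (j.+1%:R * d <= y)%R%:R <= y.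
Proof.
move=> d0 y0.
(* The cap is added to the upper bound so that the induction goes through. *)
suff /andP[-> /=] : Num.min (y - d) (N%:R * d) <=
    \sum_(j < N) d * (j.+1%:R * d <= y)%R%:R <= Num.min y (N%:R * d).
  by rewrite le_min => /andP[].
elim: N => [|N /andP[IH1 IH2]].
  by rewrite big_ord0 mul0r le_min ge_min lexx orbT y0.
rewrite big_ord_recr/=; move: IH1 IH2; set S := \sum_(_ < _) _.
have N0 : 0 <= N%:R :> R by [].
move: N0; rewrite -[N.+1]addn1 natrD mulrDl mul1r.
rewrite !le_min !ge_min; case: (leP (N%:R * d + d) y) => h N0.
  by move=> /orP[|] h1 /andP[h2 h3]; apply/andP; split;
    [apply/orP|apply/andP; split| apply/orP|apply/andP; split]; rewrite ?mulr1;
      try right; lra.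
by move=> /orP[|] h1 /andP[h2 h3]; apply/andP; split;
  [apply/orP|apply/andP; split| apply/orP|apply/andP; split]; rewrite ?mulr0;
    try left; lra.
Qed.

Lemma continuous_measurable_Rn (R : realType) (n : nat) (f : 'rV[R]_n -> R) :
  continuous f -> measurable_fun [set: Rn R n] (f : Rn R n -> R).
Proof.
move=> cf; apply: (measurability _ (RGenOpens.measurableE R)).
move=> _ [_ [a [b ->]] <-]; rewrite setTI; apply: sub_sigma_algebra.
by apply: open_comp; [move=> x _; exact: cf|exact: interval_open].
Qed.

Lemma continuous_min_cst (R : realType) (T : topologicalType)
    (f : T -> R) (c : R) :
  continuous f -> continuous (fun x => Num.min (f x) c).
Proof.
move=> cf x; have := continuous_min (cf x) (@cst_continuous _ _ c x).
exact.
Qed.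

Lemma continuous_cst_sub (R : realType) (T : topologicalType)
    (f : T -> R) (c : R) :
  continuous f -> continuous (fun x => c - f x).
Proof.
move=> cf x; have := continuousB (@cst_continuous T R^o c x) (cf x).
exact.
Qed.

Section representation.
Context (R : realType) (n : nat) (C : set 'rV[R]_n).
Local Notation pt := 'rV[R]_n.
Local Notation ultra := (g_sigma_algebraType (@measurable _ (ultrafilters pt))).
Local Notation dominated := (poly_dominated C).

Lemma poly_dominated_le (f g : pt -> R) :
  (forall x, C x -> `|f x| <= `|g x|) -> dominated g -> dominated f.
Proof.
by move=> fg [p gp]; exists p => x Cx; rewrite (le_trans (fg _ Cx))// gp.
Qed.

Lemma poly_dominated_peval p : dominated (peval p).
Proof.
(* The bound [|t| <= 1 + t ^ 2] replaces the absolute value by a polynomial. *)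
exists (1 + p ^+ 2) => x Cx; rewrite /peval mevalD meval1 rmorphXn/=.
set t := meval _ p; have := sqr_ge0 (`|t| - 1);
  rewrite -[t ^+ 2]real_normK ?num_real//.
by nra.
Qed.

Lemma poly_dominated_cst (c : R) : dominated (fun=> c).
Proof.
apply: (@poly_dominated_le _ (peval (mpolyC n c)));
  last exact: poly_dominated_peval.
by move=> x _; rewrite /peval mevalC.
Qed.

Lemma poly_dominatedD (f g : pt -> R) :
  dominated f -> dominated g -> dominated (fun x => f x + g x).
Proof.
move=> [p fp] [q gq]; exists (p + q) => x Cx.
by rewrite /peval mevalD (le_trans (ler_normD _ _))// lerD ?fp ?gq.
Qed.

Lemma poly_dominatedM (f g : pt -> R) :
  dominated f -> dominated g -> dominated (fun x => f x * g x).
Proof.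
move=> [p fp] [q gq]; exists (p * q) => x Cx.
by rewrite /peval mevalM normrM ler_pM ?fp ?gq.
Qed.

Lemma poly_dominatedZ (c : R) (f : pt -> R) :
  dominated f -> dominated (fun x => c * f x).
Proof. by apply: poly_dominatedM; exact: poly_dominated_cst. Qed.

Lemma poly_dominated_indic (A : set pt) : dominated \1_A.
Proof.
apply: (@poly_dominated_le _ (fun=> 1)); last exact: poly_dominated_cst.
by move=> x _; rewrite indicE; case: (_ \in _); rewrite ?normr1 ?normr0.
Qed.

Lemma poly_dominated_sum N (f : 'I_N -> pt -> R) :
  (forall i, dominated (f i)) -> dominated (fun x => \sum_(i < N) f i x).
Proof.
elim: N f => [|N IH] f fd.
  apply: (@poly_dominated_le _ (fun=> 0)); last exact: poly_dominated_cst.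
  by move=> x _; rewrite big_ord0.
apply: (@poly_dominated_le _ (fun x =>
    \sum_(i < N) f (widen_ord (leqnSn N) i) x + f ord_max x)).
  by move=> x _; rewrite big_ord_recr.
by apply: poly_dominatedD => //; exact: IH.
Qed.

Context (F : (pt -> R) -> R).
Hypothesis FL : forall a f g, dominated f -> dominated g ->
  F (fun x => a * f x + g x) = a * F f + F g.
Hypothesis F_ge0 : forall f, dominated f -> (forall x, C x -> 0 <= f x) ->
  0 <= F f.

Let FD f g : dominated f -> dominated g -> F (fun x => f x + g x) = F f + F g.
Proof.
move=> fd gd; rewrite -[F f]mul1r -FL//; congr F.
by apply/funext => x; rewrite mul1r.
Qed.

Let F0 : F (fun=> 0) = 0.
Proof.
have d0 := poly_dominated_cst 0.
have := FD d0 d0; rewrite (_ : (fun=> 0 + 0) = (fun=> 0));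
  last by apply/funext => x; rewrite addr0.
by move=> h; apply: (addrI (F (fun=> 0))); rewrite -h addr0.
Qed.

Let FZ a f : dominated f -> F (fun x => a * f x) = a * F f.
Proof.
move=> fd; rewrite -[RHS]addr0 -F0 -FL//; last exact: poly_dominated_cst.
by congr F; apply/funext => x; rewrite addr0.
Qed.

Let F_sum N (f : 'I_N -> pt -> R) : (forall i, dominated (f i)) ->
  F (fun x => \sum_(i < N) f i x) = \sum_(i < N) F (f i).
Proof.
elim: N f => [|N IH] f fd.
  by rewrite big_ord0 -[RHS]F0; congr F; apply/funext => x; rewrite big_ord0.
rewrite big_ord_recr/= -IH// -FD//; last exact: poly_dominated_sum.
by congr F; apply/funext => x; rewrite big_ord_recr.
Qed.

Let F_le f g : dominated f -> dominated g -> (forall x, C x -> f x <= g x) ->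
  F f <= F g.
Proof.
move=> fd gd fg; rewrite -subr_ge0 addrC -mulN1r -FL//; apply: F_ge0.
  by apply: poly_dominatedD => //; exact: poly_dominatedZ.
by move=> x Cx; rewrite mulN1r addrC subr_ge0 fg.
Qed.

Let F_indic A B : A `&` B = set0 -> F \1_(A `|` B) = F \1_A + F \1_B.
Proof.
move=> AB; rewrite -FD ?poly_dominated_indic//; try exact: poly_dominated_indic.
congr F; apply/funext => x; rewrite !indicE in_setU.
have : ~ (x \in A /\ x \in B).
  by rewrite !inE => -[Ax Bx]; have : (A `&` B) x by []; rewrite AB.
case: (x \in A); case: (x \in B) => //= h; rewrite ?addr0 ?add0r//.
by exfalso; apply: h.
Qed.

Let F_indic_ge0 A : 0 <= F \1_A.
Proof. by apply: F_ge0 => //; exact: poly_dominated_indic. Qed.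

Lemma functional_ultra_measure : exists mu : {measure set ultra -> \bar R},
  forall A, mu (ultra_clopen A) = (F \1_A)%:E.
Proof. by apply: (@stone_measure pt R (fun A => F \1_A)). Qed.

Context (mu : {measure set ultra -> \bar R}).
Hypothesis muE : forall A, mu (ultra_clopen A) = (F \1_A)%:E.
Let st := @standard_part R n.

(** Chebyshev's inequality: non-convergent ultrafilters avoid every [sqball], and the mass outside
    [sqball N.+1] is at most [c / N.+1], where [c] is the value of [F] at the squared norm. *)
Let null_ultra_cvg : mu (~` @ultra_cvg R n) = 0%E.
Proof.
have mcv := measurableC (@measurable_ultra_cvg R n).
pose c := F (peval (@sqnorm_poly R n)).
have le_mu N : (mu (~` @ultra_cvg R n) <= (c / N.+1%:R)%:E)%E.
  apply: (@le_trans _ _ (mu (ultra_clopen (~` @sqball R n N.+1%:R)))).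
    apply: le_measure; rewrite ?inE//; first exact: measurable_ultra_clopen.
    by move=> U nU; rewrite ultra_clopenC => UN; apply: nU; rewrite ultra_cvgE;
      exists N.+1.
  rewrite muE lee_fin mulrC -FZ; last exact: poly_dominated_peval.
  apply: F_le => [||x Cx]; first exact: poly_dominated_indic.
    by apply: poly_dominatedZ; exact: poly_dominated_peval.
  rewrite indicE; case: (boolP (x \in _)); rewrite ?inE => xN.
    by rewrite ler_pdivlMl// mulr1 ltW// ltNge; apply/negP.
  rewrite mulr_ge0// peval_sqnorm_poly sumr_ge0// => i _; exact: sqr_ge0.
have fin : mu (~` @ultra_cvg R n) \is a fin_num.
  by rewrite ge0_fin_numE// (le_lt_trans (le_mu 0))// ltry.
have : 0 <= fine (mu (~` @ultra_cvg R n)) by rewrite fine_ge0.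
move: le_mu; rewrite -(fineK fin); set r := fine _ => le_mu r0; congr (_%:E).
apply/eqP; rewrite eq_le r0 andbT leNgt; apply/negP => r1.
have := le_mu (Num.truncn (c / r)); rewrite lee_fin leNgt => /negP; apply.
by rewrite ltr_pdivrMr// mulrC -ltr_pdivrMr// truncnS_gt.
Qed.

Let measurable_st (f : pt -> R) : continuous f ->
  measurable_fun [set: ultra] (f \o st).
Proof.
move=> cf; apply: (@measurableT_comp _ _ _ ultra (Rn R n) R f) => //.
  exact: continuous_measurable_Rn.
exact: measurable_standard_part.
Qed.

(* Layer cake: [f] is at most [d + \sum_(j < N) d * \1_(f >= j.+1 * d)] plus an
   error that vanishes unless [f > N * d] and so is at most [f ^ 2 / (N * d)]. *)
Lemma functional_le_integral (f : pt -> R) : continuous f ->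
  (forall x, 0 <= f x) -> dominated f ->
  ((F f)%:E <= \int[mu]_U (f (st U))%:E)%E.
Proof.
move=> cf f0 fd.
have bnd d N : 0 < d -> (0 < N)%N ->
    ((F f - d * F (fun=> 1) - F (fun x => f x * f x) / (N%:R * d))%:E
    <= \int[mu]_U (f (st U))%:E)%E.
  move=> d0 N0; pose A j : set pt := [set x | j.+1%:R * d <= f x].
  have ANd i : dominated (fun x => d * \1_(A i) x).
    by apply: poly_dominatedZ; exact: poly_dominated_indic.
  have Nd0 : 0 < N%:R * d by rewrite mulr_gt0// ltr0n.
  have sumd : dominated (fun x => \sum_(j < N) d * \1_(A j) x)
    by apply: poly_dominated_sum.
  have ffd : dominated (fun x => (N%:R * d)^-1 * (f x * f x)).
    by apply: poly_dominatedZ; apply: poly_dominatedM.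
  have indicA j x : \1_(A j) x = (j.+1%:R * d <= f x)%R%:R.
    by rewrite indicE; congr (_%:R); congr nat_of_bool; apply/idP/idP;
      rewrite inE.
  have le1 : F f <= d * F (fun=> 1) + (\sum_(j < N) d * F \1_(A j) +
      (N%:R * d)^-1 * F (fun x => f x * f x)).
    rewrite -[X in _ + X](_ : F (fun x => \sum_(j < N) d * \1_(A j) x +
       (N%:R * d)^-1 * (f x * f x)) = _); last first.
      rewrite FD// F_sum// FZ; last exact: poly_dominatedM.
      by congr (_ + _); apply: eq_bigr => j _; rewrite FZ//;
        exact: poly_dominated_indic.
    rewrite -FL; last 2 first.
    - exact: poly_dominated_cst.
    - exact: poly_dominatedD.
    apply: F_le => //.
      apply: poly_dominatedD; last exact: poly_dominatedD.
      exact: poly_dominated_cst.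
    move=> x Cx; have /andP[+ _] := layer_cake_bounds N d0 (f0 x).
    under [in X in _ -> X]eq_bigr do rewrite indicA.
    set S := \sum_(_ < _) _; rewrite ge_min mulr1 => /orP[h|h].
      have : 0 <= (N%:R * d)^-1 * (f x * f x).
        by rewrite mulr_ge0 ?invr_ge0 ?mulr_ge0// ltW.
      by lra.
    have [fN|fN] := leP (f x) (N%:R * d).
      have : 0 <= (N%:R * d)^-1 * (f x * f x).
        by rewrite mulr_ge0 ?invr_ge0 ?mulr_ge0// ltW.
      by lra.
    have S0 : 0 <= S by apply: sumr_ge0 => j _; rewrite mulr_ge0// ltW.
    have : f x <= (N%:R * d)^-1 * (f x * f x).
      by rewrite ler_pdivlMl// ler_wpM2r// ltW.
    by lra.
  apply: (@le_trans _ _ (\sum_(j < N) d * F \1_(A j))%:E).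
    by rewrite lee_fin (mulrC (F (fun x => _))); lra.
  rewrite -sumEFin.
  rewrite (eq_bigr (fun j : 'I_N =>
    (\int[mu]_U (d%:E * (\1_(ultra_clopen (A j)) U)%:E))%E)); last first.
    move=> j _; rewrite ge0_integralZl_EFin//; last 2 first.
    - by apply/measurable_EFinP; apply: measurable_indic;
      exact: measurable_ultra_clopen.
    - exact: ltW.
    rewrite integral_indic//; last exact: measurable_ultra_clopen.
    by rewrite setIT muE EFinM.
  rewrite -ge0_integral_sum//; last 2 first.
  - move=> j; apply: measurable_funeM; apply/measurable_EFinP;
    apply: measurable_indic.
    exact: measurable_ultra_clopen.
  - by move=> j U _; rewrite -EFinM lee_fin mulr_ge0// ltW.
  apply: ae_ge0_le_integral => //.
  - by move=> U _; apply: sume_ge0 => j _; rewrite -EFinM lee_fin mulr_ge0//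
    ltW.
  - apply: emeasurable_sum => j; apply: measurable_funeM;
    apply/measurable_EFinP; apply: measurable_indic.
    exact: measurable_ultra_clopen.
  - by move=> U _; rewrite lee_fin.
  - by apply/measurable_EFinP; exact: measurable_st.
  (* Off this null set, if [U] contains the closed set [A j] then so does [A j] contain the limit of
     [U]; the indicators are thus bounded by those of the levels of [f (st U)]. *)
  exists (~` @ultra_cvg R n); split => //; first exact: measurableC
    (@measurable_ultra_cvg R n).
  move=> U /= nU cU; apply: nU => _.
  under eq_bigr do rewrite -EFinM.
  rewrite sumEFin lee_fin; have /andP[_] := layer_cake_bounds N d0 (f0 (st U)).
  apply: le_trans; apply: ler_sum => j _; rewrite ler_wpM2l ?(ltW d0)//.
  rewrite indicE; case: (boolP (U \in _)) => //; rewrite inE => UA.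
  suff -> : j.+1%:R * d <= f (st U) by rewrite lexx.
  apply: (@closed_standard_part R n U (A j)) => //.
  apply: (@closed_comp _ _ f [set t | j.+1%:R * d <= t]); last exact: closed_ge.
  by move=> x _; exact: cf.
have I0 : (0 <= \int[mu]_U (f (st U))%:E)%E by apply: integral_ge0 => U _;
  rewrite lee_fin.
move: bnd I0; case: (\int[mu]_U _)%E => [r| |]//; last by move=> _ _;
  rewrite leey.
move=> bnd _; rewrite lee_fin; apply/ler_addgt0Pr => e e0.
have F1 : 0 <= F (fun=> 1) by apply: F_ge0 => //; exact: poly_dominated_cst.
set c := F (fun=> 1) in bnd F1; set c2 := F (fun x => f x * f x) in bnd.
(* First [d] makes the rounding error at most [e / 2], with [c + 1] in place of [c] as [c] may
   vanish; then [N] does the same for the tail. *)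
pose d := e / 2 / (c + 1).
have d0 : 0 < d by rewrite !divr_gt0// ltr_wpDl.
have dc : d * c <= e / 2.
  by rewrite /d mulrAC ler_pdivrMr ?ltr_wpDl// ler_wpM2l ?lerDl// ltW//
    divr_gt0.
pose N := (Num.truncn (c2 / (d * (e / 2)))).+1.
have c2N : c2 / (N%:R * d) <= e / 2.
  have Nd0 : 0 < N%:R * d by rewrite mulr_gt0// ltr0n.
  have de0 : 0 < d * (e / 2) by rewrite mulr_gt0// divr_gt0.
  by rewrite ler_pdivrMr// mulrC -mulrA -ler_pdivrMr// ltW// truncnS_gt.
by have := bnd d N d0 isT; rewrite lee_fin; lra.
Qed.

(* Apply the previous lemma to [k - min(f, k)], then let [k] tend to infinity. *)
Lemma integral_le_functional (f : pt -> R) : continuous f ->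
  (forall x, 0 <= f x) -> dominated f ->
  (\int[mu]_U (f (st U))%:E <= (F f)%:E)%E.
Proof.
move=> cf f0 fd; pose g (k : nat) x := Num.min (f x) k%:R.
have cg k : continuous (g k).
  exact: continuous_min_cst.
have g0 k x : 0 <= g k x by rewrite le_min f0/=.
have gd k : dominated (g k).
  apply: (poly_dominated_le _ fd) => x _.
  by rewrite (ger0_norm (g0 k x)) (ger0_norm (f0 x)) /g ge_min lexx.
have mg k : measurable_fun [set: ultra] (fun U => (g k (st U))%:E).
  by apply/measurable_EFinP; exact: measurable_st.
have gF k : (\int[mu]_U (g k (st U))%:E <= (F f)%:E)%E.
  have h0 x : 0 <= k%:R - g k x by rewrite subr_ge0 ge_min lexx orbT.
  have ch : continuous (fun x => k%:R - g k x).
    exact: continuous_cst_sub.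
  have hd : dominated (fun x => k%:R - g k x).
    apply: poly_dominatedD; first exact: poly_dominated_cst.
    by apply: (poly_dominated_le _ (gd k)) => x _; rewrite normrN.
  have := functional_le_integral ch h0 hd.
  (* Both sides equal [k] times the total mass, which is [F] of the constant [1]. The lower bound on
     the second integral thus becomes an upper bound on the first. *)
  have : (\int[mu]_U (g k (st U))%:E + \int[mu]_U (k%:R - g k (st U))%:E =
          (F (g k))%:E + (F (fun x => k%:R - g k x))%:E)%E.
    rewrite -ge0_integralD//; last 3 first.
    - by move=> U _; rewrite lee_fin.
    - by move=> U _; rewrite lee_fin.
    - by apply/measurable_EFinP; exact: (measurable_st ch).
    rewrite -EFinD -FD//.
    under eq_integral do rewrite -EFinD subrKC.
    rewrite integral_cst// -[setT](_ : ultra_clopen setT = _); last first.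
      by apply/seteqP; split => // U _; have UF := ultraP U; exact: filterT.
    rewrite muE -EFinM -FZ; last exact: poly_dominated_indic.
    congr (F _)%:E; apply/funext => x; rewrite subrKC indicE in_setT mulr1//.
  move=> + le1; move: (\int[mu]_U (k%:R - g k (st U))%:E)%E le1 => b.
  case: b => [b| |]//; last first.
    by move=> _; rewrite addey// -ltNye (lt_le_trans (ltNyr 0))//
      integral_ge0// => U _; rewrite lee_fin.
  rewrite lee_fin => Fb.
  have : (0 <= \int[mu]_U (g k (st U))%:E)%E by apply: integral_ge0 => U _;
    rewrite lee_fin.
  case: (\int[mu]_U (g k (st U))%:E)%E => [a| |]//= _; rewrite -?EFinD.
  move=> [ab]; rewrite lee_fin; apply: (@le_trans _ _ (F (g k))); first by lra.
  by apply: F_le => // x _; rewrite ge_min lexx.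
have glim U : limn (fun k => (g k (st U))%:E) = (f (st U))%:E.
  apply/cvg_lim => //; apply: cvg_near_cst; exists (Num.truncn (f (st U))).+1.
    by [].
  move=> k /= fk.
  congr (_%:E); apply/min_idPl; rewrite ltW// (lt_le_trans (truncnS_gt _))//
    ler_nat//.
have nd (U : ultra) : setT U ->
    {homo (fun k => (g k (st U))%:E) : k l / (k <= l)%N >-> (k <= l)%E}.
  move=> _ k l kl; rewrite lee_fin /g le_min ge_min lexx/=.
  by apply: (le_trans (y := k%:R)); [rewrite ge_min lexx orbT|rewrite ler_nat].
have g0E k (U : ultra) : setT U -> (0 <= (g k (st U))%:E)%E by rewrite lee_fin.
have := @cvg_monotone_convergence _ _ _ mu _ measurableT _ mg g0E nd.
rewrite (eq_integral (fun U : ultra => (f (st U))%:E)); last by move=> U _;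
  exact: glim.
move=> cv; rewrite -(cvg_lim _ cv)//; apply: lime_le; first by apply: cvgP;
  exact: cv.
by apply: nearW => k; exact: gF.
Qed.

Lemma ge0_integral_standard_part (f : pt -> R) :
  continuous f -> (forall x, 0 <= f x) -> dominated f ->
  (\int[mu]_U (f (st U))%:E = (F f)%:E)%E.
Proof.
move=> cf f0 fd; apply/eqP; rewrite eq_le integral_le_functional//=.
exact: functional_le_integral.
Qed.

(** The sets [inner_nbhd V k] also miss [C], so [F] vanishes on their indicators. Their clopens,
    with the non-convergent ultrafilters, cover the preimage of [V]. *)
Lemma null_standard_part (V : set pt) : open V -> (forall x, C x -> ~ V x) ->
  mu (st @^-1` V) = 0%E.
Proof.
move=> oV CV; have mV : measurable (st @^-1` V : set ultra).
  rewrite -[X in measurable X]setTI.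
  by apply: measurable_standard_part => //; exact: sub_sigma_algebra.
apply/negligibleP => //.
have : mu.-negligible ((~` @ultra_cvg R n `|`
    \bigcup_k ultra_clopen (inner_nbhd V k)) : set ultra).
  apply: negligibleU.
    by apply/negligibleP => //; exact: measurableC (@measurable_ultra_cvg R n).
  apply: negligible_bigcup => k; apply/negligibleP;
    first exact: measurable_ultra_clopen.
  transitivity (F \1_(inner_nbhd V k))%:E; first exact: muE.
  suff -> : F \1_(inner_nbhd V k) = 0 by [].
  rewrite -[RHS]F0; apply/eqP; rewrite eq_le.
  by apply/andP; split; apply: F_le;
    do ?[exact: poly_dominated_indic|exact: poly_dominated_cst];
    move=> x Cx; rewrite indicE memNset// => kx; apply: (CV _ Cx); apply: kx;
      exact: ballxx.
apply: negligibleS => U VU; have [cU|] := pselect (@ultra_cvg R n U);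
  last by left.
by right; have [k Uk] := (standard_part_inner_nbhd cU oV).1 VU; exists k.
Qed.

Let standard_part_measure : set (Rn R n) -> \bar R :=
  pushforward mu (st : ultra -> Rn R n).

Let spm0 : standard_part_measure set0 = 0%E.
Proof.
by rewrite /standard_part_measure /pushforward preimage_set0 measure0.
Qed.

Let spm_ge0 A : (0 <= standard_part_measure A)%E.
Proof. exact: (measure_ge0 mu). Qed.

Let spm_sigma_additive : semi_sigma_additive standard_part_measure.
Proof.
have mst (A : set (Rn R n)) : measurable A -> measurable (st @^-1` A : set
  ultra).
  by move=> mA; rewrite -[X in measurable X]setTI;
    exact: measurable_standard_part.
move=> G mG tG mUG; rewrite /standard_part_measure /pushforward preimage_bigcup.
apply: measure_semi_sigma_additive => [i||]; first exact: mst.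
  move=> i j _ _ [U [Gi Gj]]; apply: (tG i j I I); by exists (st U).
by rewrite -preimage_bigcup; exact: mst.
Qed.

HB.instance Definition _ := measure_function.isMeasure.Build _ _ _
  standard_part_measure
  spm0 spm_ge0 spm_sigma_additive.

(** The positive and negative parts of a polynomial are continuous and dominated, so the integral
    formula for nonnegative functions applies to each of them. *)
Lemma haviland_of_extension (L : mpoly n R -> R) :
  closed C -> (forall p, F (peval p) = L p) ->
  exists nu : {measure set (Rn R n) -> \bar R}, nu (~` C) = 0%E /\
    forall p, nu.-integrable setT (fun x => (peval p x)%:E) /\
      (\int[nu]_x (peval p x)%:E = (L p)%:E)%E.
Proof.
move=> cC FLp.
have mst := @measurable_standard_part R n.
pose nu := standard_part_measure.
have nuE (f : pt -> R) : continuous f -> (forall x, 0 <= f x) -> dominated f ->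
    (\int[nu]_x (f x)%:E = (F f)%:E)%E.
  move=> cf f0 fd; rewrite ge0_integral_pushforward//; last 2 first.
  - by apply/measurable_EFinP; exact: continuous_measurable_Rn.
  - by move=> x _; rewrite lee_fin.
  exact: ge0_integral_standard_part.
exists nu; split.
  by apply: null_standard_part; [exact: closed_openC|move=> x Cx; exact].
move=> p; have cp := @continuous_peval R n p.
have mp : measurable_fun [set: Rn R n] (fun x => (peval p x)%:E).
  by apply/measurable_EFinP; exact: continuous_measurable_Rn.
have pd := poly_dominated_peval p.
have cmax (f : pt -> R) : continuous f -> continuous (fun x => Num.max (f x) 0).
  move=> cf; have -> : (fun x => Num.max (f x) 0) = (fun x =>
    0 - Num.min (0 - f x) 0).
    by apply/funext => x; rewrite !sub0r oppr_min opprK oppr0.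
  by apply: continuous_cst_sub; apply: continuous_min_cst;
    exact: continuous_cst_sub.
have dmax (f : pt -> R) : dominated f -> dominated (fun x => Num.max (f x) 0).
  apply: poly_dominated_le => x _; have [fx|fx] := leP (f x) 0;
    first by rewrite normr0.
  by [].
have cN : continuous (fun x => 0 - peval p x : R) by exact: continuous_cst_sub.
have dN : dominated (fun x => 0 - peval p x).
  by apply: (poly_dominated_le _ pd) => x _; rewrite sub0r normrN.
have max0 (f : pt -> R) x : 0 <= Num.max (f x) 0 by rewrite le_max lexx orbT.
split.
  apply/integrableP; split => //.
  rewrite (eq_integral (fun x : Rn R n => (Num.max (peval p x) 0 + Num.max (0
    - peval p x) 0)%:E)).
    rewrite nuE ?ltry//.
    - move=> x; have := continuousD (cmax _ cp x) (cmax _ cN x); exact.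
    - by move=> x; apply: addr_ge0; rewrite le_max lexx orbT.
    - by apply: poly_dominatedD; exact: dmax.
  move=> x _; rewrite abse_EFin; congr (_%:E); rewrite sub0r.
  have [h|h] := leP (peval p x) 0.
    by rewrite ler0_norm// add0r max_l ?oppr_ge0.
  by rewrite gtr0_norm// max_r ?addr0// oppr_le0 ltW.
rewrite integralE.
rewrite (eq_integral (fun x : Rn R n => (Num.max (peval p x) 0)%:E));
  last first.
  by move=> x _; rewrite funeposE EFin_max.
rewrite [X in (_ - X)%E](eq_integral (fun x : Rn R n =>
  (Num.max (0 - peval p x) 0)%:E)); last first.
  by move=> x _; rewrite funenegE EFin_max sub0r.
rewrite (nuE _ (cmax _ cp) (max0 _) (dmax _ pd)) (nuE _ (cmax _ cN) (max0 _)
  (dmax _ dN)).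
rewrite -EFinB -FLp; congr (_%:E).
(* This is additivity of [F] for the identity [p^+ = p + p^-]. *)
apply/eqP; rewrite subr_eq -(FD pd (dmax _ dN)).
apply/eqP; congr F; apply/funext => x; rewrite sub0r.
have [h|h] := leP (peval p x) 0.
  by rewrite max_l ?oppr_ge0// subrr.
by rewrite max_r ?addr0// oppr_le0 ltW.
Qed.

End representation.

(** * Haviland's theorem and moment sequences *)

Theorem haviland (R : realType) (n : nat) (C : set 'rV[R]_n) (L : mpoly n R ->
  R) :
  closed C -> linear_for *%R L -> (forall p, Pos C p -> 0 <= L p) ->
  exists nu : {measure set (Rn R n) -> \bar R}, nu (~` C) = 0%E /\
    forall p, nu.-integrable setT (fun x => (peval p x)%:E) /\
      (\int[nu]_x (peval p x)%:E = (L p)%:E)%E.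
Proof.
move=> cC L_linear L_pos.
have [F [FLp FL F_ge0]] := positive_extension L_linear L_pos.
have [mu muE] := functional_ultra_measure FL F_ge0.
exact: (haviland_of_extension FL F_ge0 muE).
Qed.

Section moments.
Context (R : realType) (n : nat).
Local Notation pt := 'rV[R]_n.
Implicit Types (mu : {measure set (Rn R n) -> \bar R}) (s : multinom n -> R).

Lemma representing_integral mu s p : representing mu s ->
  mu.-integrable setT (fun x => (peval p x)%:E) /\
  (\int[mu]_x (peval p x)%:E = (moment_functional s p)%:E)%E.
Proof.
move=> mus.
have pE : (fun x : Rn R n => (peval p x)%:E) =
    (fun x => \sum_(a <- msupp p) (mcoeff a p)%:E * (mono a x)%:E)%E.
  by apply/funext => x; rewrite /peval mevalE -sumEFin; apply: eq_bigr.
have ai a : mu.-integrable setT (fun x => (mcoeff a p)%:E * (mono a x)%:E)%E.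
  by apply: integrableZl => //; have [] := mus a.
rewrite pE; split; first exact: integrable_sum.
rewrite integral_sum// /moment_functional -sumEFin; apply: eq_bigr => a _.
by have [mia mE] := mus a; rewrite integralZl// mE EFinM.
Qed.

(** Each point outside the support has a null open neighbourhood, and finitely many of these cover a
    compact set. *)
Lemma compact_null mu (A : set pt) : compact A ->
  measurable (A : set (Rn R n)) ->
  (forall x, A x -> ~ supp mu x) -> mu A = 0%E.
Proof.
move=> cA mA Asupp.
pose D : set (set pt) := [set U | open U /\ mu U = 0%E].
have := cA; rewrite compact_cover => /(_ _ D id) [U []//|x|E ED AE].
  move=> /Asupp; rewrite /supp/= => /existsNP[U] /not_implyP[oU].
  move=> /not_implyP[Ux] /negP; rewrite lt0e measure_ge0 andbT negbK => /eqP U0.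
  by exists U.
apply/negligibleP => //.
apply: (@negligibleS _ (Rn R n) _ mu _ _ AE).
rewrite /cover bigcup_fset big_seq_cond.
elim/big_ind : _ => [||U UE]; first exact: negligible_set0.
  by move=> U V; exact: negligibleU.
have [oU U0] : D U by move: UE; rewrite andbT => /ED/set_mem.
by apply/negligibleP => //; exact: sub_sigma_algebra.
Qed.

(** The set where [p] is negative is a countable union of compact sets missing the support, hence
    null, so the integral of [p] is nonnegative. *)
Lemma moment_functional_ge0 s (C : set pt) p :
  moment_seq C s -> Pos C p -> 0 <= moment_functional s p.
Proof.
move=> [mu [mus suppC]] pC; have [pint pE] := representing_integral p mus.
pose N : set (Rn R n) := [set x | peval p x < 0].
have cp := @continuous_peval R n p.
have oN : open (N : set pt).
  apply: (@open_comp _ _ (peval p : pt -> R) [set t | t < 0]);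
    last exact: open_lt.
  by move=> x _; exact: cp.
have mN : measurable N by exact: sub_sigma_algebra.
have N0 : mu N = 0%E.
  pose A k : set pt := sqball k%:R `&` [set x | peval p x <= - k.+1%:R^-1].
  have clA k : closed [set x : pt | peval p x <= - k.+1%:R^-1].
    apply: (@closed_comp _ _ (peval p : pt -> R) [set t | t <= - k.+1%:R^-1]);
      last exact: closed_le.
    by move=> x _; exact: cp.
  have clS k : closed (A k) by apply: closedI => //; exact: closed_sqball.
  have mA k : measurable (A k : set (Rn R n)).
    by rewrite -[A k]setCK; apply: measurableC; apply: sub_sigma_algebra;
      exact: closed_openC.
  apply/negligibleP => //.
  have NA : N `<=` \bigcup_k A k.
    (* The index exceeds both the squared norm of [x] and the inverse of [- p(x)]. *)
    move=> x /= x0; pose k := (Num.truncn (Num.max (peval (@sqnorm_poly R n)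
      x) (- (peval p x))^-1)).+1.
    exists k => //; split.
      by rewrite /sqball/=; apply: ltW; apply: le_lt_trans (truncnS_gt _);
        rewrite le_max lexx.
    have px : (- peval p x)^-1 < k.+1%:R.
      apply: (@lt_trans _ _ k%:R); last by rewrite ltr_nat.
      by apply: le_lt_trans (truncnS_gt _); rewrite le_max lexx orbT.
    rewrite /= lerNr -(invrK (- _)) lef_pV2 ?posrE ?invr_gt0 ?oppr_gt0//.
    exact: ltW.
  suff : mu.-negligible (\bigcup_k A k : set (Rn R n)) by apply: negligibleS.
  apply: negligible_bigcup => k; apply/negligibleP => //;
    apply: compact_null => //.
    apply: (subclosed_compact (clS k) (@compact_sqball R n k%:R)).
    by move=> x [].
  move=> x [_ /= px] /suppC /pC; rewrite leNgt => /negP; apply.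
  by rewrite (le_lt_trans px)// oppr_lt0 invr_gt0.
rewrite -lee_fin -pE (negligible_integral mN measurableT pint N0).
by apply: integral_ge0 => x [_ /negP]; rewrite -leNgt lee_fin.
Qed.

(** The coefficients of [D(s)] are constant, so determinacy at any one point is determinacy of
    [s]. *)
Lemma Dcoef_moment s y :
  (fun a => (mfact a)%:R * peval (Dcoef s a) y) = s.
Proof.
apply/funext => a; rewrite /peval mevalC mulrC divfK//.
by rewrite pnatr_eq0 -lt0n mfact_gt0.
Qed.

Lemma closed_translate (K : set pt) y : closed K -> closed [set x | K (x + y)].
Proof.
move=> cK; apply: (@closed_comp _ _ (fun x : pt => x + y) K) => // x _.
by apply: continuousD; [exact: cvg_id|exact: cst_continuous].
Qed.

Lemma translate_null mu s (K : set pt) y : closed K -> K y ->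
  pos_preserver K (Dop s) -> representing mu s -> determinate s ->
  mu [set x | ~ K (x + y)] = 0%E.
Proof.
move=> cK Ky Kpos mus [_ dets].
pose C : set pt := [set x | K (x + y)].
have cC : closed C by exact: closed_translate.
have [|nu [nuC nuL]] := haviland cC (@moment_functional_is_linear R n s).
  (* A polynomial nonnegative on [K - y] is the translate by [y] of one nonnegative on [K]. *)
  move=> p pC; rewrite -(shift_polyK y p) -peval_Dop; apply: Kpos Ky.
  move=> x Kx; rewrite peval_shift_poly; apply: pC.
  by rewrite /C/= subrK.
have nus : representing nu s.
  move=> a; have [ai aE] := nuL (mpolyX R a).
  have monoE : (fun x : Rn R n => (mono a x)%:E) = (fun x =>
    (peval (mpolyX R a) x)%:E).
    by apply/funext => x; rewrite /peval mevalX.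
  by rewrite monoE; split; rewrite // aE moment_functionalX.
rewrite (dets mu nu mus nus)//.
by apply: sub_sigma_algebra; exact: (closed_openC cC).
Qed.

End moments.

Theorem theorem4p12 (R : realType) (n : nat) (K : set 'rV[R]_n)
  (s : mpoly.multinom n -> R) :
  K !=set0 -> closed K ->
  (det_pos_preserver K (Dcoef s) <->
   (moment_seq (Ksharp K) s /\ determinate s)).
Proof.
move=> [k0 Kk0] cK; split.
  (* Determinacy of [s] is read off at the point [k0] of [K]. *)
  move=> [Kpos detK]; have dets : determinate s.
    by have := detK k0 Kk0; rewrite Dcoef_moment.
  split => //; have [[mu mus] _] := dets; exists mu; split => // x xmu k Kk.
  apply: contrapT => nK.
  (* The complement of [K - k] would be an open neighbourhood of a point of the support, hence of
     positive measure, although it is null. *)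
  have /xmu := closed_openC (closed_translate cK (y := k)).
  by move=> /(_ nK); rewrite (translate_null cK Kk Kpos mus dets) ltxx.
move=> [smom dets]; split; last by move=> y _; rewrite Dcoef_moment.
move=> p pK y Ky; rewrite -/(Dop s p) peval_Dop.
apply: moment_functional_ge0 smom _ => x xK.
by rewrite peval_shift_poly; apply: pK; exact: xK.
Qed.
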